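(* Let $(X,T)$ be a topological dynamical system, let $\mathrm{scl}=\{\mathrm{scl}_\alpha\}_{\alpha\ge0}$ be a scaling, let $E\subset X$ be a Borel set, and fix $\mu\in\mathscr M(X)$. Then for any $\alpha>0$: (1) If $\underline h_{\mu,\mathrm{scl}}(T,x)\le\alpha$ for all $x\in E$, then $h^{B}_{\mathrm{scl}}(T,E)\le\alpha$. (2) If $\mu(E)>0$ and $\underline h_{\mu,\mathrm{scl}}(T,x)\ge\alpha$ for all $x\in E$, then $h^{B}_{\mathrm{scl}}(T,E)\ge\alpha$.
   Context: A topological dynamical system $(X,T)$ consists of a compact metric space $(X,d)$ and a continuous map $T:X\to X$. $\mathscr M(X)$ is the set of Borel probability measures on $X$. Put $d_n(x,y)=\max_{0\le j<n}d(T^jx,T^jy)$ and $B_n(x,\epsilon)=\{y\in X: d_n(x,y)<\epsilon\}$. A scaling is a family $\mathrm{scl}=(\mathrm{scl}_\alpha)_{\alpha\ge0}$ of positive non-decreasing functions on $(0,1)$ such that for all $\alpha>\beta>0$ and every $\lambda>1$ sufficiently close to $1$, $\mathrm{scl}_\alpha(\epsilon)=o(\mathrm{scl}_\beta(\epsilon^\lambda))$ and $\mathrm{scl}_\alpha(\epsilon)=o(\mathrm{scl}_\beta(\epsilon)^\lambda)$ as $\epsilon\to0^+$. Bowen entropy scale: $M_{\mathrm{scl}_\alpha}(T,E,\epsilon,N)=\inf\sum_{i\in I}\mathrm{scl}_\alpha(e^{-n_i})$, the infimum over finite or countable covers $\{B_{n_i}(x_i,\epsilon)\}_{i\in I}$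 of $E$ with $n_i\ge N$, $x_i\in X$; $M_{\mathrm{scl}_\alpha}(T,E)=\lim_{\epsilon\to0}\lim_{N\to\infty}M_{\mathrm{scl}_\alpha}(T,E,\epsilon,N)$; $h^B_{\mathrm{scl}}(T,E)=\sup\{\alpha>0:M_{\mathrm{scl}_\alpha}(T,E)=\infty\}=\inf\{\alpha>0:M_{\mathrm{scl}_\alpha}(T,E)=0\}$ (the two agree; $\sup\emptyset=0$, $\inf\emptyset=+\infty$). Lower local entropy scale: $\underline h_{\mu,\mathrm{scl}_\alpha}(T,x,\epsilon)=\liminf_{n\to\infty}\frac{\mathrm{scl}_\alpha(e^{-n})}{\mu(B_n(x,\epsilon))}$, where the quotient is $+\infty$ if $\mu(B_n(x,\epsilon))=0$; $\underline h_{\mu,\mathrm{scl}}(T,x,\epsilon)=\inf\{\alpha>0:\underline h_{\mu,\mathrm{scl}_\alpha}(T,x,\epsilon)=0\}=\sup\{\alpha>0:\underline h_{\mu,\mathrm{scl}_\alpha}(T,x,\epsilon)=\infty\}$ (same conventions); $\underline h_{\mu,\mathrm{scl}}(T,x)=\lim_{\epsilon\to0}\underline h_{\mu,\mathrm{scl}}(T,x,\epsilon)$. *)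

(* Defs.v *)
From HB Require Import structures.
From mathcomp Require Import all_boot all_order all_algebra.
From mathcomp Require Import all_classical all_reals all_analysis.

Set Implicit Arguments.
Unset Strict Implicit.
Unset Printing Implicit Defensive.

Import Order.TTheory GRing.Theory Num.Theory.
Import numFieldNormedType.Exports.

Local Open Scope classical_set_scope.
Local Open Scope ring_scope.

(* The library's generated sigma-algebras live on pointed types.  A space that
   carries a probability measure is nonempty, so the point costs nothing. *)
#[short(type="pmetricType")]
HB.structure Definition PointedMetric (R : numDomainType) :=
  { M of Metric R M & Pointed M }.

Notation borelType X := (g_sigma_algebraType (@open X)).

(* [scl a e] stands for scl_a(e); only a >= 0 and 0 < e < 1 are meaningful. *)
Definition scaling (R : realType) (scl : R -> R -> R) : Prop :=
  [/\ forall a e, 0 <= a -> 0 < e < 1 -> 0 < scl a e,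
      forall a e e', 0 <= a -> 0 < e < 1 -> 0 < e' < 1 ->
        e <= e' -> scl a e <= scl a e'
    & forall a b, 0 < b -> b < a ->
        \forall l \near 1^'+,
          ((scl a : R -> R^o) =o_ (0^'+) (fun e => scl b (e `^ l) : R^o)) /\
          ((scl a : R -> R^o) =o_ (0^'+) (fun e => scl b e `^ l : R^o))].

Section BowenBalls.
Context {R : realType} {X : pmetricType R}.
Variable T : X -> X.

Definition bowen_dist (n : nat) (x y : X) : R :=
  \big[Order.max/0]_(j < n) mdist (iter j T x) (iter j T y).

Definition bowen_ball (n : nat) (x : X) (eps : R) : set X :=
  [set y | bowen_dist n x y < eps].

End BowenBalls.

Section BowenEntropy.
Context {R : realType} {X : pmetricType R}.
Variables (scl : R -> R -> R) (T : X -> X).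

(* A finite or countable family is indexed by a subset [I] of [nat]. *)
Definition bowen_cover (E : set X) (eps : R) (N : nat)
    (I : set nat) (n : nat -> nat) (x : nat -> X) : Prop :=
  (forall i, I i -> (N <= n i)%N) /\
  E `<=` \bigcup_(i in I) bowen_ball T (n i) (x i) eps.

(* For N = 0 the value scl_a(e^0) at the endpoint 1 may occur; it is discarded
   by the limit in N below. *)
Definition bowen_preM (a : R) (E : set X) (eps : R) (N : nat) : \bar R :=
  ereal_inf [set s | exists I n x, bowen_cover E eps N I n x /\
    s = (\esum_(i in I) (scl a (expR (- (n i)%:R)))%:E)%E].

Definition bowen_M (a : R) (E : set X) : \bar R :=
  lim (limn (bowen_preM a E eps) @[eps --> 0^'+]).

(* Adjoining 0 encodes the convention sup set0 = 0 (the library has -oo). *)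
Definition bowen_entropy (E : set X) : \bar R :=
  ereal_sup (0%E |` [set a%:E | a in [set a | 0 < a /\ bowen_M a E = +oo%E]]).

End BowenEntropy.

Section LowerLocalEntropy.
Context {R : realType} {X : pmetricType R}.
Variables (scl : R -> R -> R) (T : X -> X) (mu : probability (borelType X) R).

(* Division in [\bar R] has 0^-1 = +oo, so the quotient of a positive number
   by a null measure is +oo. *)
Definition lower_local_ratio (a : R) (x : X) (eps : R) : \bar R :=
  limn_einf (fun n =>
    (scl a (expR (- n%:R)))%:E / mu (bowen_ball T n x eps))%E.

Definition lower_local_entropy_at (x : X) (eps : R) : \bar R :=
  ereal_inf [set a%:E | a in
    [set a | 0 < a /\ lower_local_ratio a x eps = 0%E]].

Definition lower_local_entropy (x : X) : \bar R :=
  lim (lower_local_entropy_at x eps @[eps --> 0^'+]).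

End LowerLocalEntropy.

(* Main.v *)
Require Import Defs.
From HB Require Import structures.
From mathcomp Require Import all_boot all_order all_algebra.
From mathcomp Require Import all_classical all_reals all_analysis.

Import Order.TTheory GRing.Theory Num.Theory.
Import numFieldNormedType.Exports.

Local Open Scope classical_set_scope.
Local Open Scope ring_scope.

(* (1) If a > alpha, then for every N and eps each x in E has some n >= N with
   scl_a(e^-n) <= mu(B_n(x,eps)).  A Vitali selection, giving priority to small
   n (that is, to large balls), extracts disjoint balls B_n(x,eps) whose
   enlargements B_n(x,2eps) cover E; their weights add up to at most 1, so
   M_a(E) <= 1.
   (2) If 0 < g < b < alpha, some subset A of E of positive outer measure
   satisfies r mu(B_n(y,eps)) <= scl_b(e^-n) uniformly in y in A and n >= N.
   Replacing each ball of radius eps/2 of a cover by one of radius eps centred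
   in A bounds the scl_b-weight of every cover below by r mu*(A); since
   scl_b = o(scl_g), M_g(E) is infinite. *)

Set Implicit Arguments.
Unset Strict Implicit.
Unset Printing Implicit Defensive.

(** * Selection of disjoint families of sets *)

(** Each [B i] contains a nonempty basic open set, and disjointness makes the choice of it injective
    into a countable base. *)
Lemma second_countable_trivIset (T : topologicalType) (I : Type) (B : I -> set T)
    (D : set I) :
  @second_countable T -> (forall i, D i -> open (B i)) ->
  (forall i, D i -> B i !=set0) -> trivIset D B -> countable D.
Proof.
move=> [C cC [_ basisC]] oB B0 tB.
have [V CV] : {V : I -> set T & forall i, D i ->
    [/\ C (V i), V i !=set0 & V i `<=` B i]}.
  apply: (@choice _ _ (fun i W => D i -> [/\ C W, W !=set0 & W `<=` B i])) => i.
  have [Di|notD] := pselect (D i); last by exists set0 => /notD.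
  have [x Bx] := B0 _ Di.
  have [W [CW Wx WB]] := basisC x (B i) (open_nbhs_nbhs (conj (oB _ Di) Bx)).
  by exists W => _; split => //; exists x.
have injV : {in D &, injective V}.
  move=> i j /set_mem Di /set_mem Dj Vij; apply: tB => //.
  have [_ [x Vx] ViB] := CV _ Di; have [_ _ VjB] := CV _ Dj.
  by exists x; split; [exact: ViB|apply: VjB; rewrite -Vij].
rewrite -(eq_countable (inj_card_eq injV)).
by apply: sub_countable cC; apply: subset_card_le => _ [i Di <-]; have [] := CV _ Di.
Qed.

(* Level n of the construction adds a maximal disjoint family among the indices
   i with m i = n whose B i avoids everything selected at lower levels. *)
Lemma leveled_disjoint_subcollection (T I : Type) (B : I -> set T)
    (m : I -> nat) (D : set I) : (forall i, D i -> B i !=set0) ->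
  exists C, [/\ C `<=` D, trivIset C B &
    forall i, D i -> exists j, [/\ C j, (m j <= m i)%N & B j `&` B i !=set0]].
Proof.
move=> B0.
pose free n (C : set I) := [set i | [/\ D i, m i = n &
  forall j, C j -> B j `&` B i = set0]].
(* [C n] collects what the levels below [n] select, so level [m i] is settled in [C (m i).+1]. *)
pose C := fix C n := if n is k.+1 then
  C k `|` projT1 (ex_maximal_disjoint_subcollection B (free k (C k)))
  else set0.
have CS k : C k.+1 =
  C k `|` projT1 (ex_maximal_disjoint_subcollection B (free k (C k))) by [].
have Cmono n k : (n <= k)%N -> C n `<=` C k.
  elim: k => [|k ih]; first by rewrite leqn0 => /eqP ->.
  rewrite leq_eqVlt => /predU1P[->//|]; rewrite ltnS => /ih nk.
  by apply: subset_trans nk _; rewrite CS; exact: subsetUl.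
have Cprop n i : C n i -> D i /\ (m i < n)%N.
  elim: n => //= n ih [/ih[? /ltnW]//|].
  by case: ex_maximal_disjoint_subcollection => /= A [Afree _ _] /Afree[? ->].
have Ctriv n : trivIset (C n) B.
  elim: n => [|n ih]; first by move=> ? ? [].
  rewrite CS; case: ex_maximal_disjoint_subcollection => /= A [Afree tA _].
  move=> i j [Ci|Ai] [Cj|Aj] ij; [exact: ih| | |exact: tA].
  - by have [_ _ /(_ _ Ci) ij0] := Afree _ Aj; move: ij; rewrite ij0 => -[].
  - have [_ _ /(_ _ Cj) ij0] := Afree _ Ai.
    by move: ij; rewrite setIC ij0 => -[].
exists (\bigcup_n C n); split.
- by move=> i [n _ /Cprop[]].
- move=> i j [n _ Ci] [k _ Cj]; apply: (Ctriv (maxn n k)).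
    exact: Cmono (leq_maxl _ _) _ Ci.
  exact: Cmono (leq_maxr _ _) _ Cj.
- move=> i Di.
  have [[j Cj ij]|noj] := pselect (exists2 j, C (m i).+1 j & B j `&` B i !=set0).
    by exists j; split => //; [exists (m i).+1|have [] := Cprop _ _ Cj].
  (* If nothing selected so far met [B i], then [i] could be added to [A], against maximality; [i]
     is not in [A] already because [B i] is nonempty. *)
  exfalso; move: noj; rewrite CS.
  case: ex_maximal_disjoint_subcollection => /= A [Afree tA maxA] noj.
  have disj j : C (m i) j \/ A j -> B j `&` B i = set0.
    move=> CAj; apply/eqP; apply/negPn/negP => /set0P ji.
    by apply: noj; exists j.
  have nAi : ~ A i.
    by move=> Ai; have /B0/set0P/eqP := Di; rewrite -[B i]setIid disj//; right.
  apply: (maxA (i |` A)).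
  + by split; [exact: subsetUr|move=> /(_ i) /(_ (or_introl erefl))].
  + move=> j [->|/Afree//]; split => // k Ck; apply: disj; by left.
  + move=> j k [->|Aj] [->|Ak] jk //; last exact: tA.
    * by move: jk; rewrite setIC disj; [case|right].
    * by move: jk; rewrite disj; [case|right].
Qed.

(** * Lower limits in the extended reals *)

Section limn_einf_lemmas.
Local Open Scope ereal_scope.
Context {R : realType}.
Implicit Types (u v : (\bar R)^nat) (c : \bar R).

Lemma limn_einf_ge u c N : (forall n, (N <= n)%N -> c <= u n) ->
  c <= limn_einf u.
Proof.
move=> cu; rewrite limn_einf_lim; apply: lime_ge; first exact: is_cvg_einfs.
near=> n; apply: le_ereal_inf_tmp => _ [k /= nk <-]; apply: cu.
by apply: leq_trans nk; near: n; exists N.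
Unshelve. all: by end_near. Qed.

(** The lower limit is the supremum of the infima over tails, so a value strictly below it lies
    below the infimum of some tail. *)
Lemma limn_einf_gt u c : c < limn_einf u ->
  exists N, forall n, (N <= n)%N -> c < u n.
Proof.
rewrite limn_einf_lim (cvg_lim _ (@cvg_einfs_sup _ u))//.
move=> /ereal_sup_gt[_ [n _ <-] cn].
exists n => k nk; apply: (lt_le_trans cn); apply: ereal_inf_lbound.
by exists k.
Qed.

End limn_einf_lemmas.

(** * Scalings along the sequence e^-n *)

Section scaling_lemmas.
Context {R : realType}.
Variables (scl : R -> R -> R).
Hypothesis sclP : scaling scl.

Lemma expRN_in01 n : (0 < n)%N -> 0 < expR (- n%:R : R) < 1.
Proof. by move=> n0; rewrite expR_gt0 -[ltRHS]expR0 ltr_expR oppr_lt0 ltr0n. Qed.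

Lemma scl_expRN_gt0 a n : 0 <= a -> (0 < n)%N -> 0 < scl a (expR (- n%:R)).
Proof. by case: sclP => + _ _ a0 n0; apply => //; exact: expRN_in01. Qed.

Lemma cvg_expRN : expR (- n%:R) @[n --> \oo] --> (0 : R)^'+.
Proof.
move=> A /cvgn_expR A0.
have : \forall n \near \oo, 0 < expR (- n%:R : R) -> A (expR (- n%:R)) by [].
by apply: filterS => n; apply; exact: expR_gt0.
Qed.

(** For l > 1 and e < 1 one has e^l <= e, so monotonicity bounds scl_b(e^l) by scl_b(e); then
    scl_a(e) = o(scl_b(e^l)) gives C scl_a <= scl_b near 0, in particular at e^-n. *)
Lemma scaling_dominated a b C : 0 < b -> b < a -> 0 < C ->
  \forall n \near \oo, C * scl a (expR (- n%:R)) <= scl b (expR (- n%:R)).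
Proof.
move=> b0 ba C0; have [pos mono /(_ _ _ b0 ba) small] := sclP.
have a0 := lt_trans b0 ba.
have [l [l1 [lo _]]] : exists l : R, 1 < l /\
    ((scl a : R -> R^o) =o_ (0^'+) (fun e => scl b (e `^ l) : R^o)) /\
    ((scl a : R -> R^o) =o_ (0^'+) (fun e => scl b e `^ l : R^o)).
  near (1 : R)^'+ => l; exists l; split; near: l => //.
  exact: nbhs_right_gt.
have {lo}Ca : \forall e \near (0 : R)^'+, C * scl a e <= scl b e.
  have Ci0 : 0 < C^-1 by rewrite invr_gt0.
  have /eqoP/(_ _ Ci0) := lo.
  move=> loC; near=> e.
  have e0 : 0 < e by near: e; exact: nbhs_right_gt.
  have e1 : e < 1 by near: e; exact: nbhs_right_lt.
  have el0 : 0 < e `^ l by rewrite powR_gt0.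
  have ele : e `^ l <= e.
    by apply: ge1r_powR; rewrite ?e0 ?ltW.
  have el1 := le_lt_trans ele e1.
  have : `|scl a e| <= C^-1 * `|scl b (e `^ l)|.
    near: e. exact: loC.
  have a01 : 0 < e < 1 by rewrite e0.
  have b01 : 0 < e `^ l < 1 by rewrite el0.
  rewrite (gtr0_norm (pos _ _ (ltW a0) a01)) (gtr0_norm (pos _ _ (ltW b0) b01)).
  move=> aCb.
  rewrite -ler_pdivlMl//; apply: (le_trans aCb); rewrite ler_pM2l//.
  exact: (mono _ _ _ (ltW b0)).
exact: cvg_expRN Ca.
Unshelve. all: by end_near. Qed.

End scaling_lemmas.

Section bowen_ball_lemmas.
Context {R : realType} {X : pmetricType R}.
Variable T : X -> X.
Implicit Types (x y : X) (e : R) (n : nat).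

Lemma bowen_ballP n x e y : 0 < e ->
  bowen_ball T n x e y <->
  forall j, (j < n)%N -> mdist (iter j T x) (iter j T y) < e.
Proof.
move=> e0; split=> [/bigmax_ltP[_ xy] j jn|xy].
  exact: (xy (Ordinal jn)).
by apply/bigmax_ltP; split => // j _; exact: xy.
Qed.

Lemma bowen_ball_center n x e : 0 < e -> bowen_ball T n x e x.
Proof. by move=> e0; apply/bowen_ballP => // j _; rewrite mdistxx. Qed.

Lemma bowen_ball_sym n x e y : bowen_ball T n x e y -> bowen_ball T n y e x.
Proof.
by rewrite /bowen_ball/= /bowen_dist; under eq_bigr do rewrite metric_sym.
Qed.

Lemma bowen_ball_triangle n y x z e1 e2 : 0 < e1 -> 0 < e2 ->
  bowen_ball T n x e1 y -> bowen_ball T n y e2 z ->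
  bowen_ball T n x (e1 + e2) z.
Proof.
move=> e10 e20 /bowen_ballP xy /bowen_ballP yz.
apply/bowen_ballP => [|j jn]; first exact: addr_gt0.
apply: le_lt_trans (metric_triangle _ (iter j T y) _) _.
by rewrite ltrD ?xy ?yz.
Qed.

Lemma le_bowen_ball n x e1 e2 : e1 <= e2 ->
  bowen_ball T n x e1 `<=` bowen_ball T n x e2.
Proof. by move=> e12 y /lt_le_trans; exact. Qed.

Lemma sub_bowen_ball m n x e : 0 < e -> (m <= n)%N ->
  bowen_ball T n x e `<=` bowen_ball T m x e.
Proof.
move=> e0 mn y /bowen_ballP xy; apply/bowen_ballP => // j jm.
by apply: xy => //; exact: leq_trans mn.
Qed.

(** Membership amounts to finitely many strict inequalities between continuous functions of the
    point. *)
Lemma open_bowen_ball n x e : continuous T -> 0 < e -> open (bowen_ball T n x e).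
Proof.
move=> cT e0; rewrite openE => y /bowen_ballP xy.
have citer j : continuous (iter j T).
  elim: j => [|j ih] z; first exact: cvg_id.
  exact: (continuous_comp (ih z) (cT _)).
have : \forall z \near y, forall j : 'I_n, mdist (iter j T x) (iter j T z) < e.
  apply: filter_forall => j.
  have d0 : 0 < e - mdist (iter j T x) (iter j T y) by rewrite subr_gt0 xy.
  have : \forall z \near y, ball (iter j T y) (e - mdist (iter j T x) (iter j T y))
    (iter j T z) := citer j y _ (nbhsx_ballx _ _ d0).
  apply: filterS => z; rewrite ballEmdist/= ltrBrDl.
  exact: le_lt_trans (metric_triangle _ _ _).
by apply: filterS => z xz; apply/bowen_ballP => // j jn; exact: (xz (Ordinal jn)).
Qed.

Lemma measurable_bowen_ball n x e : continuous T -> 0 < e ->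
  measurable (bowen_ball T n x e : set (borelType X)).
Proof. by move=> cT e0; apply: sub_gen_smallest; exact: open_bowen_ball. Qed.

End bowen_ball_lemmas.

(** * Local entropy: quotients and dependence on the radius *)

Section local_entropy_lemmas.
Context {R : realType} {X : pmetricType R}.
Variables (scl : R -> R -> R) (T : X -> X) (mu : probability (borelType X) R).
Hypotheses (sclP : scaling scl) (cT : continuous T).

Let u a x e n :=
  ((scl a (expR (- n%:R)))%:E / mu (bowen_ball T n x e))%E.

Lemma lower_local_ratio_ge0 a x e : 0 <= a ->
  (0 <= lower_local_ratio scl T mu a x e)%E.
Proof.
move=> a0; apply: (@limn_einf_ge _ _ _ 1) => n n1.
by rewrite mule_ge0// ?inve_ge0// lee_fin ltW// scl_expRN_gt0.
Qed.

(** Otherwise the quotient would be at least 1 from some index on, and so would its lower limit. *)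
Lemma lower_local_ratio_eq0P a x e N : 0 <= a -> 0 < e ->
  lower_local_ratio scl T mu a x e = 0%E ->
  exists n, (N <= n)%N /\
    ((scl a (expR (- n%:R)))%:E <= mu (bowen_ball T n x e))%E.
Proof.
move=> a0 e0 h0.
(* The 1 in [maxn N 1] keeps e^-n inside (0,1), where the scaling is positive. *)
have [[n Nn un]|noN] := pselect (exists2 n, (maxn N 1 <= n)%N & (u a x e n < 1)%E).
  move: Nn; rewrite geq_max => /andP[Nn n1].
  exists n; split => //.
  have sa := scl_expRN_gt0 sclP a0 n1.
  have mub : mu (bowen_ball T n x e) \is a fin_num.
    apply: fin_num_measure; exact: measurable_bowen_ball.
  move: un; rewrite /u -(fineK mub) inver.
  (* A null ball has quotient +oo, which is not below 1. *)
  case: ifPn => [_|mu0]; first by rewrite gt0_muley// ltNge leey.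
  rewrite -EFinM lte_fin ltr_pdivrMr ?mul1r ?lee_fin => [/ltW//|].
  by rewrite lt_neqAle eq_sym mu0 fine_ge0.
exfalso.
have : (1 <= lower_local_ratio scl T mu a x e)%E.
  apply: (@limn_einf_ge _ _ _ (maxn N 1)) => n Nn; rewrite leNgt.
  by apply/negP => un; apply: noN; exists n.
by rewrite h0 lee_fin ler10.
Qed.

(** A positive lower limit exceeds some real r > 0, and then so does a whole tail of quotients. *)
Lemma lower_local_ratio_neq0P a x e : 0 <= a -> 0 < e ->
  lower_local_ratio scl T mu a x e != 0%E ->
  exists N r, 0 < r /\ forall n, (N <= n)%N ->
    (r%:E * mu (bowen_ball T n x e) <= (scl a (expR (- n%:R)))%:E)%E.
Proof.
move=> a0 e0 h0.
have : (0 < lower_local_ratio scl T mu a x e)%E.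
  by rewrite lt_neqAle eq_sym h0 lower_local_ratio_ge0.
move=> h1.
have [r r0 rh] : exists2 r, 0 < r & (r%:E < lower_local_ratio scl T mu a x e)%E.
  case: (lower_local_ratio scl T mu a x e) h1 => [h||]//.
    rewrite lte_fin => h1; exists (h / 2); rewrite ?divr_gt0//.
    by rewrite lte_fin ltr_pdivrMr// ltr_pMr// ltr1n.
  by exists 1 => //; exact: ltry.
have [N uN] := limn_einf_gt rh.
exists (maxn N 1), r; split => // n; rewrite geq_max => /andP[/uN + n1].
have sa := scl_expRN_gt0 sclP a0 n1.
have mub : mu (bowen_ball T n x e) \is a fin_num.
  apply: fin_num_measure; exact: measurable_bowen_ball.
rewrite -(fineK mub) inver; case: ifPn => [/eqP -> _|mu0].
  by rewrite mule0 lee_fin ltW.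
rewrite -!EFinM lte_fin lee_fin ltr_pdivlMr => [/ltW//|].
by rewrite lt_neqAle eq_sym mu0 fine_ge0.
Qed.

(** A smaller ball has a larger quotient. So a lower limit that vanishes at [e1] vanishes at [e2],
    where the infimum is thus over a larger set. *)
Lemma lower_local_entropy_at_nonincreasing x e1 e2 : 0 < e1 -> e1 <= e2 ->
  (lower_local_entropy_at scl T mu x e2 <= lower_local_entropy_at scl T mu x e1)%E.
Proof.
move=> e10 e12; have e20 := lt_le_trans e10 e12.
apply: le_ereal_inf_tmp => _ [a [a0 h0] <-]; apply: ereal_inf_lbound.
exists a => //; split => //; apply/eqP/negPn/negP => h2.
have [N [r [r0 rN]]] := lower_local_ratio_neq0P (ltW a0) e20 h2.
have : (r%:E <= lower_local_ratio scl T mu a x e1)%E; last first.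
  by rewrite h0 lee_fin leNgt r0.
apply: (@limn_einf_ge _ _ _ (maxn N 1)) => n; rewrite geq_max => /andP[/rN + n1].
have sa := scl_expRN_gt0 sclP (ltW a0) n1.
have mub e : 0 < e -> mu (bowen_ball T n x e) \is a fin_num.
  move=> ?; apply: fin_num_measure; exact: measurable_bowen_ball.
move=> rs.
have {rs} : (r%:E * mu (bowen_ball T n x e1) <= (scl a (expR (- n%:R)))%:E)%E.
  apply: le_trans rs; apply: lee_wpmul2l; first by rewrite lee_fin ltW.
  apply: le_measure; rewrite ?inE; [exact: measurable_bowen_ball..|].
  exact: le_bowen_ball.
rewrite -(fineK (mub _ e10)) inver; case: ifPn => [_ _|mu0].
  by rewrite gt0_muley// leey.
rewrite -!EFinM !lee_fin ler_pdivlMr//.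
by rewrite lt_neqAle eq_sym mu0 fine_ge0.
Qed.

Lemma lower_local_entropy_cvg x :
  lower_local_entropy_at scl T mu x e @[e --> 0^'+] -->
  lower_local_entropy scl T mu x.
Proof.
apply: nonincreasing_at_right_is_cvge; near=> d => e1 e2.
rewrite !in_itv/= => /andP[e10 _] _; exact: lower_local_entropy_at_nonincreasing.
Unshelve. all: by end_near. Qed.

Lemma lower_local_entropy_at_le x e : 0 < e ->
  (lower_local_entropy_at scl T mu x e <= lower_local_entropy scl T mu x)%E.
Proof.
move=> e0; apply: lime_ge; first exact: lower_local_entropy_cvg.
near=> d; apply: lower_local_entropy_at_nonincreasing; near: d.
  exact: nbhs_right_gt.
exact: nbhs_right_le.
Unshelve. all: by end_near. Qed.

End local_entropy_lemmas.

(** * Vitali covering and mass distribution *)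

(** Disjoint balls of radius [e] have total measure at most 1, which bounds the weights. Doubling
    the radius is enough because only the centres in [E] have to be covered. *)
Lemma bowen_vitali_cover {R : realType} {X : pmetricType R} (T : X -> X)
    (mu : probability (borelType X) R) (s : nat -> R) (E : set X) e N :
  @second_countable X -> continuous T -> 0 < e ->
  (forall x, E x -> exists n, (N <= n)%N /\
    ((s n)%:E <= mu (bowen_ball T n x e))%E) ->
  exists I n x, bowen_cover T E (e + e) N I n x /\
    (\esum_(i in I) (s (n i))%:E <= 1)%E.
Proof.
move=> cX cT e0 Es.
have [m Em] : {m : X -> nat & forall x, E x -> (N <= m x)%N /\
    ((s (m x))%:E <= mu (bowen_ball T (m x) x e))%E}.
  apply: (@choice _ _ (fun x m => E x -> (N <= m)%N /\
    ((s m)%:E <= mu (bowen_ball T m x e))%E)) => x.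
  have [/Es[n nP]|nEx] := pselect (E x); first by exists n.
  by exists 0%N => /nEx.
pose B x := bowen_ball T (m x) x e.
have [x Ex|C [CE tC coverC]] := @leveled_disjoint_subcollection _ _ B m E.
  by exists x; exact: bowen_ball_center.
have : countable C.
  apply: (@second_countable_trivIset _ _ B) => //.
    by move=> x _; exact: open_bowen_ball.
  by move=> x _; exists x; exact: bowen_ball_center.
(* Covers are indexed by subsets of [nat]: the centres in [C] are transported along an injection
   [f], with inverse [g] on its image. *)
move=> /countable_injP[f injf].
have [g gP] : {g : nat -> X & forall i, (f @` C) i -> C (g i) /\ f (g i) = i}.
  apply: (@choice _ _ (fun i x => (f @` C) i -> C x /\ f x = i)) => i.
  have [[x Cx fx]|nfC] := pselect ((f @` C) i); first by exists x.
  by exists point => /nfC.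
exists (f @` C), (m \o g), g; split; first split.
- by move=> i /gP[/CE/Em[]].
- move=> x /coverC[c [Cc mcx [z [cz xz]]]].
  have fCc : (f @` C) (f c) by exists c.
  have [Cg fg] := gP _ fCc.
  exists (f c) => //; have -> : g (f c) = c by apply: injf; rewrite ?inE.
  rewrite /=; have -> : g (f c) = c by apply: injf; rewrite ?inE.
  (* The point [z] lies in both balls, and [m c <= m x] lets the ball about [x] be read at the
     shorter time [m c]. *)
  apply: (@bowen_ball_triangle _ _ _ _ z) => //.
  by apply: bowen_ball_sym; exact: sub_bowen_ball xz.
have tg : trivIset (f @` C) (B \o g).
  move=> i j /gP[Ci fi] /gP[Cj fj] ij.
  by rewrite -fi -fj; congr f; exact: tC.
have mB i : (f @` C) i -> measurable (B (g i) : set (borelType X)).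
  by move=> _; exact: measurable_bowen_ball.
apply: (@le_trans _ _ (\esum_(i in f @` C) mu (B (g i)))%E).
  by apply: le_esum => i /gP[/CE/Em[]].
rewrite -[X in \esum_(i in X) _]set_mem_set -nneseries_esum//.
rewrite -measure_bigcup//.
apply: probability_le1; exact: bigcup_measurable.
Qed.

(** A ball of radius [e] meeting [A] at a point lies in the ball of radius [e + e] about that point,
    whose measure is controlled. These larger balls cover [A]. *)
Lemma mass_distribution {R : realType} {X : pmetricType R} (T : X -> X)
    (mu : probability (borelType X) R) (s : nat -> R) (E A : set X) e N c I n x :
  continuous T -> 0 < e -> 0 <= c -> A `<=` E ->
  (forall k, (N <= k)%N -> 0 <= s k) ->
  (forall y k, A y -> (N <= k)%N ->
    (c%:E * mu (bowen_ball T k y (e + e)) <= (s k)%:E)%E) ->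
  bowen_cover T E e N I n x ->
  (c%:E * mu_ext mu (A : set (borelType X)) <= \esum_(i in I) (s (n i))%:E)%E.
Proof.
move=> cT e0 c0 AE s0 As [In Ecover].
have e20 : 0 < e + e by exact: addr_gt0.
have [F FP] : {F : nat -> set (borelType X) & forall i,
    [/\ measurable (F i), I i -> A `&` bowen_ball T (n i) (x i) e `<=` F i &
     (c%:E * mu (F i) <= if i \in I then (s (n i))%:E else 0)%E]}.
  apply: (@choice _ _ (fun i (F : set (borelType X)) =>
    [/\ measurable F, I i -> A `&` bowen_ball T (n i) (x i) e `<=` F &
     (c%:E * mu F <= if i \in I then (s (n i))%:E else 0)%E])) => i.
  have [[Ii [y [Ay xy]]]|noy] :=
      pselect (I i /\ (A `&` bowen_ball T (n i) (x i) e) !=set0).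
    exists (bowen_ball T (n i) y (e + e)); split.
    - exact: measurable_bowen_ball.
    - move=> _ z [Az xz]; apply: (@bowen_ball_triangle _ _ _ _ (x i)) => //.
      exact: bowen_ball_sym.
    - by rewrite mem_set//; apply: As => //; exact: In.
  (* A ball that misses [A], or an index outside [I], gets the empty set, at no cost. *)
  exists set0; split => //.
  - by move=> Ii z Az; apply: noy; split => //; exists z.
  - rewrite measure0 mule0; case: ifPn => // /set_mem Ii.
    by rewrite lee_fin s0// In.
rewrite [leRHS]esum_mkcond.
apply: (@le_trans _ _ (c%:E * \sum_(k <oo) mu (F k))%E).
  apply: lee_wpmul2l; first by rewrite lee_fin.
  apply: ereal_inf_lbound; exists F => //; split.
    by move=> i; have [] := FP i.
  move=> y Ay; have [i Ii xy] := Ecover _ (AE _ Ay).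
  by exists i => //; have [_ + _] := FP i; apply.
rewrite -nneseriesZl// nneseries_esumT => [|k]; last exact: mule_ge0.
by apply: le_esum => k _; have [] := FP k.
Qed.

(** * Monotonicity of the covering sums and bounds on their limits *)

Section bowen_entropy_lemmas.
Context {R : realType} {X : pmetricType R}.
Variables (scl : R -> R -> R) (T : X -> X) (E : set X).

Lemma bowen_preM_nondecreasing a e :
  {homo bowen_preM scl T a E e : N M / (N <= M)%N >-> (N <= M)%E}.
Proof.
move=> N M NM; apply: le_ereal_inf_tmp => _ [I [n [x [[In cov] ->]]]].
apply: ereal_inf_lbound; exists I, n, x; split => //; split => // i /In.
exact: leq_trans.
Qed.

Lemma bowen_preM_nonincreasing a N e1 e2 : e1 <= e2 ->
  (bowen_preM scl T a E e2 N <= bowen_preM scl T a E e1 N)%E.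
Proof.
move=> e12; apply: le_ereal_inf_tmp => _ [I [n [x [[In cov] ->]]]].
apply: ereal_inf_lbound; exists I, n, x; split => //; split => // y /cov[i Ii].
by move=> xy; exists i => //; exact: le_bowen_ball xy.
Qed.

Lemma limn_bowen_preM_nonincreasing a e1 e2 : e1 <= e2 ->
  (limn (bowen_preM scl T a E e2) <= limn (bowen_preM scl T a E e1))%E.
Proof.
move=> e12; apply: lee_lim; [exact: ereal_nondecreasing_is_cvgn
  (bowen_preM_nondecreasing _ _)..|].
by apply: nearW => n; exact: bowen_preM_nonincreasing.
Qed.

Lemma bowen_M_le a c :
  (forall e N, 0 < e -> (bowen_preM scl T a E e N <= c)%E) ->
  (bowen_M scl T a E <= c)%E.
Proof.
move=> preMc; apply: lime_le.
  apply: nonincreasing_at_right_is_cvge; near=> d => e1 e2 _ _.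
  exact: limn_bowen_preM_nonincreasing.
near=> e; apply: lime_le.
  exact: ereal_nondecreasing_is_cvgn (bowen_preM_nondecreasing _ _).
apply: nearW => N; apply: preMc; near: e; exact: nbhs_right_gt.
Unshelve. all: by end_near. Qed.

(** The limit in [N] only grows as the radius shrinks, so an infinite value at one radius persists
    at all smaller ones. *)
Lemma bowen_M_pinfty a e : 0 < e ->
  (forall A : R, exists N, (A%:E <= bowen_preM scl T a E e N)%E) ->
  bowen_M scl T a E = +oo%E.
Proof.
move=> e0 preMy.
have limy : limn (bowen_preM scl T a E e) = +oo%E.
  apply/cvg_lim => //; apply/cvgeyPge => A.
  have [N AN] := preMy A; near=> n; apply: (le_trans AN).
  by apply: bowen_preM_nondecreasing; near: n; exists N.
apply: lim_near_cst => //; near=> d; apply/eqP; rewrite -leye_eq -limy.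
apply: limn_bowen_preM_nonincreasing; near: d; exact: nbhs_right_le.
Unshelve. all: by end_near. Qed.

End bowen_entropy_lemmas.

(** * The two entropy inequalities *)

Section entropy_distribution.
Context {R : realType} {X : pmetricType R}.
Variables (scl : R -> R -> R) (T : X -> X) (E : set X).
Variables (mu : probability (borelType X) R).
Hypotheses (cT : continuous T) (sclP : scaling scl).

Lemma bowen_entropy_le alpha : 0 < alpha -> @second_countable X ->
  (forall x, E x -> (lower_local_entropy scl T mu x <= alpha%:E)%E) ->
  (bowen_entropy scl T E <= alpha%:E)%E.
Proof.
move=> alpha0 cX Ealpha; apply: ge_ereal_sup => _ [->|[a [a0 May] <-]].
  by rewrite lee_fin ltW.
rewrite lee_fin leNgt; apply/negP => alphaa.
suff : (bowen_M scl T a E <= 1)%E by rewrite May.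
apply: bowen_M_le => e N e0.
(* The selection doubles radii, so it starts from e/2. *)
have [I [n [x [cov sum1]]]] : exists I n x, bowen_cover T E (e / 2 + e / 2) N I n x /\
    (\esum_(i in I) (scl a (expR (- (n i)%:R)))%:E <= 1)%E.
  have e20 : 0 < e / 2 by rewrite divr_gt0.
  apply: (@bowen_vitali_cover _ _ _ mu (fun n => scl a (expR (- n%:R)))) => //.
  move=> x Ex.
  have : (lower_local_entropy_at scl T mu x (e / 2) < a%:E)%E.
    apply: le_lt_trans (lower_local_entropy_at_le mu sclP cT x e20) _.
    by apply: le_lt_trans (Ealpha _ Ex) _; rewrite lte_fin.
  (* Some [b < a] has lower limit 0; domination with constant 1 passes from scl_b to the eventually
     smaller scl_a. *)
  move=> /ereal_inf_lt[_ [b [b0 h0] <-]]; rewrite lte_fin => ba.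
  have [N1 _ dom] := scaling_dominated sclP b0 ba ltr01.
  have [n [+ sn]] := lower_local_ratio_eq0P sclP cT (maxn N N1) (ltW b0) e20 h0.
  rewrite geq_max => /andP[Nn /dom/=]; rewrite mul1r => sab.
  by exists n; split => //; apply: le_trans sn; rewrite lee_fin.
rewrite -splitr in cov; apply: le_trans sum1.
by apply: ereal_inf_lbound; exists I, n, x.
Qed.

(** The radius, threshold and constant of each point are merged into one integer k: radius and
    constant 1/(k+1), threshold k. Countably many sets then cover [E], and by subadditivity one has
    positive outer measure. *)
Lemma exists_uniform_mass b : 0 < b -> measurable (E : set (borelType X)) ->
  (0 < mu E)%E ->
  (forall x, E x -> (b%:E < lower_local_entropy scl T mu x)%E) ->
  exists A N r e, [/\ A `<=` E, 0 < r, 0 < e, (0 < mu_ext mu (A : set (borelType X)))%E &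
    forall y k, A y -> (N <= k)%N ->
    (r%:E * mu (bowen_ball T k y e) <= (scl b (expR (- k%:R)))%:E)%E].
Proof.
move=> b0 mE muE Eb.
(* The outer measure mu_ext spares proving that the sets A k are measurable. *)
pose A k := [set x | E x /\ forall n, (k <= n)%N ->
  (k.+1%:R^-1%:E * mu (bowen_ball T n x k.+1%:R^-1) <= (scl b (expR (- n%:R)))%:E)%E].
have EA : E `<=` \bigcup_k A k.
  move=> x Ex.
  have [e e0 xe] : exists2 e, 0 < e & (b%:E < lower_local_entropy_at scl T mu x e)%E.
    apply: contrapT => noe.
    have : (lower_local_entropy scl T mu x <= b%:E)%E.
      apply: lime_le; first exact: lower_local_entropy_cvg.
      near=> e; have e0 : 0 < e by near: e; exact: nbhs_right_gt.
      by rewrite leNgt; apply/negP => be; apply: noe; exists e.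
    by rewrite leNgt Eb.
  have h0 : lower_local_ratio scl T mu b x e != 0%E.
    apply/eqP => h0; move: xe; rewrite ltNge => /negP; apply.
    by apply: ereal_inf_lbound; exists b.
  have [N [r [r0 rN]]] := lower_local_ratio_neq0P sclP cT (ltW b0) e0 h0.
  have [k [Nk ke kr]] : exists k, [/\ (N <= k)%N, k.+1%:R^-1 <= e & k.+1%:R^-1 <= r].
    near \oo => k; exists k; split; near: k.
    - by exists N.
    - by apply: filterS (near_infty_natSinv_lt (PosNum e0)) => k /ltW.
    - by apply: filterS (near_infty_natSinv_lt (PosNum r0)) => k /ltW.
  exists k => //; split => // n kn.
  (* Shrinking the constant and the radius only weakens the inequality. *)
  apply: le_trans (rN _ (leq_trans Nk kn)); apply: lee_pmul => //.
  by apply: le_measure; rewrite ?inE;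
    [exact: measurable_bowen_ball..|exact: le_bowen_ball].
have [k Ak] : exists k, (0 < mu_ext mu (A k : set (borelType X)))%E.
  apply: contrapT => /forallNP noA.
  have : (mu_ext mu (E : set (borelType X)) <= 0)%E.
    apply: (le_trans (le_mu_ext mu EA)).
    apply: (le_trans (mu_ext_sigma_subadditive (@measure_ge0 _ _ _ mu) _)).
    rewrite eseries0// => i _ _; apply/eqP.
    by rewrite eq_le mu_ext_ge0// andbT leNgt; apply/negP/noA.
  by rewrite measurable_mu_extE// leNgt muE.
exists (A k), k, k.+1%:R^-1, k.+1%:R^-1; split => //.
- by move=> x [].
- by move=> y n [_]; exact.
Unshelve. all: by end_near. Qed.

Lemma bowen_entropy_ge alpha : measurable (E : set (borelType X)) ->
  (0 < mu E)%E ->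
  (forall x, E x -> (alpha%:E <= lower_local_entropy scl T mu x)%E) ->
  (alpha%:E <= bowen_entropy scl T E)%E.
Proof.
move=> mE muE Ealpha; apply/lee_addgt0Pr => d d0.
(* For [alpha <= d] the 0 adjoined to the supremum suffices. *)
have [alphad|dalpha] := leP alpha d.
  apply: (@le_trans _ _ d%:E); first by rewrite lee_fin.
  by rewrite leeDr//; apply: ereal_sup_ubound; left.
rewrite -leeBlDr// -EFinB.
set g := alpha - d; have g0 : 0 < g by rewrite subr_gt0.
apply: ereal_sup_ubound; right; exists g => //; split => //.
(* The midpoint of [g] and [alpha]: below [alpha], it is strictly exceeded by the local entropy;
   above [g], it makes scl_b negligible against scl_g. *)
pose b := g + d / 2.
have gb : g < b by rewrite ltrDl divr_gt0.
have balpha : b < alpha.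
  by rewrite /b /g -addrA gtrDl addrC subr_lt0 ltr_pdivrMr// ltr_pMr// ltr1n.
have b0 : 0 < b by exact: lt_trans gb.
have [|A [N [r [e [AE r0 e0 muA Ar]]]]] := exists_uniform_mass b0 mE muE.
  by move=> x /Ealpha; apply: lt_le_trans; rewrite lte_fin.
have muAfin : mu_ext mu (A : set (borelType X)) \is a fin_num.
  rewrite ge0_fin_numE ?mu_ext_ge0//.
  apply: le_lt_trans (le_mu_ext mu AE) _.
  by rewrite measurable_mu_extE// -ge0_fin_numE// fin_num_measure.
have {}muA : 0 < fine (mu_ext mu (A : set (borelType X))).
  by rewrite fine_gt0// muA -ge0_fin_numE// mu_ext_ge0.
have e20 : 0 < e / 2 by rewrite divr_gt0.
apply: (bowen_M_pinfty e20) => M.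
(* Times the outer measure of [A], this constant is max(M,1) >= M; the 1 makes it positive. *)
pose C := Num.max M 1 / fine (mu_ext mu (A : set (borelType X))).
have C0 : 0 < C by rewrite divr_gt0// lt_max ltr01 orbT.
(* The inequality (C/r) scl_b <= scl_g turns r mu(B) <= scl_b into C mu(B) <= scl_g, as
   [mass_distribution] requires. *)
have [K _ dom] := scaling_dominated sclP g0 gb (divr_gt0 C0 r0).
exists (maxn (maxn N K) 1); apply: le_ereal_inf_tmp => _ [I [n [x [cov ->]]]].
apply: (@le_trans _ _ (C%:E * mu_ext mu (A : set (borelType X)))%E).
  by rewrite -(fineK muAfin) -EFinM lee_fin divfK ?gt_eqF// le_max lexx.
apply: (@mass_distribution _ _ _ _ (fun n => scl g (expR (- n%:R))) E _ (e / 2)) cov => //.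
- exact: ltW.
- by move=> k; rewrite !geq_max => /andP[_ k0]; rewrite ltW// scl_expRN_gt0// ltW.
- move=> y k Ay; rewrite !geq_max -splitr => /andP[/andP[Nk Kk] k0].
  have := dom _ Kk; rewrite /= -lee_fin => /(le_trans _); apply.
  have -> : C%:E = ((C / r)%:E * r%:E)%E by rewrite -EFinM divfK ?gt_eqF.
  rewrite -muleA (EFinM (C / r)).
  by apply: lee_wpmul2l; [rewrite lee_fin divr_ge0// ltW|exact: Ar].
Qed.

End entropy_distribution.

Unset Implicit Arguments.
Set Strict Implicit.
Set Printing Implicit Defensive.

Theorem theorem3p2 (R : realType) (X : pmetricType R) (T : X -> X)
    (scl : R -> R -> R) (E : set X) (mu : probability (borelType X) R)
    (compactX : compact [set: X]) (contT : continuous T)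
    (scl_scaling : scaling scl)
    (borelE : measurable (E : set (borelType X)))
    (alpha : R) (alpha_gt0 : 0 < alpha) :
  ((forall x, E x -> (lower_local_entropy scl T mu x <= alpha%:E)%E) ->
     (bowen_entropy scl T E <= alpha%:E)%E) /\
  ((0 < mu E)%E ->
   (forall x, E x -> (alpha%:E <= lower_local_entropy scl T mu x)%E) ->
     (alpha%:E <= bowen_entropy scl T E)%E).
Proof.
split=> [|muE]; last exact: bowen_entropy_ge.
by apply: bowen_entropy_le => //; exact: compact_second_countable.
Qed.
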